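(* Let $d\geqslant 1$ and $\beta\geqslant 2$ be integers and let $1\leqslant\gamma_1\leqslant\ldots\leqslant\gamma_{d-1}\leqslant\lfloor\beta/2\rfloor$ be positive integers. For $k=1,\ldots,\beta-1$ put \[ \mu_k=2(d-1)-2\sum_{m=1}^{d-1}\cos(2\pi k\gamma_m/\beta), \] which, for $k=1,\ldots,\beta-1$, are the eigenvalues of the combinatorial Laplacian on the circulant graph $C^{\gamma_1,\ldots,\gamma_{d-1}}_\beta$ other than the one with index $k=0$ (the paper calls them its non-zero eigenvalues). Then for every integer $n\geqslant 1$, the number of spanning trees of the circulant graph $C^{1,\gamma_1n,\ldots,\gamma_{d-1}n}_{\beta n}$ is \[ \tau\big(C^{1,\gamma_1n,\ldots,\gamma_{d-1}n}_{\beta n}\big)=\frac{n}{\beta}\prod_{k=1}^{\beta-1}\Big(\big(\mu_k/2+1+\sqrt{\mu_k^2/4+\mu_k}\big)^n+\big(\mu_k/2+1-\sqrt{\mu_k^2/4+\mu_k}\big)^n-2\cos(2\pi k/\beta)\Big). \]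
   Context: For positive integers $N$ and $1\leqslant c_1\leqslant\ldots\leqslant c_r\leqslant\lfloor N/2\rfloor$, the circulant graph $C^{c_1,\ldots,c_r}_N$ is the $2r$-regular graph on vertex set $\mathbb{Z}/N\mathbb{Z}$ in which each vertex $v$ is joined to $v+c_i$ and $v-c_i$ mod $N$ for each $i=1,\ldots,r$ (edges counted with multiplicity, so that the graph is $2r$-regular). Its combinatorial Laplacian is $\Delta f(x)=\sum_{y\sim x}(f(x)-f(y))$ (sum over neighbours with multiplicity), with eigenvalues $2r-2\sum_{i=1}^r\cos(2\pi k c_i/N)$, $k=0,\ldots,N-1$. $\tau(G)$ denotes the number of spanning trees of $G$ (parallel edges distinguished), which by the matrix tree theorem equals $\frac{1}{|V(G)|}$ times the product of the non-zero Laplacian eigenvalues. *)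

(* Defs.v *)
From HB Require Import structures.
From mathcomp Require Import all_boot all_order all_algebra.
From mathcomp Require Import all_classical all_reals all_analysis.

Set Implicit Arguments.
Unset Strict Implicit.
Unset Printing Implicit Defensive.

Import GRing.Theory.
Local Open Scope ring_scope.

(* Finite undirected multigraphs: edges have their own identity, so parallel
   edges are distinguished; the order of the two ends of an edge is irrelevant
   (everything below goes through [joins], which is symmetric in x and y). *)
Record multigraph := Multigraph {
  vertex : finType;
  edge : finType;
  ends : edge -> vertex * vertex }.

Section Multigraph.
Variable G : multigraph.
Implicit Types (x y : vertex G) (e : edge G) (T : {set edge G}).

Definition joins e x y : bool := (ends e == (x, y)) || (ends e == (y, x)).

Definition multiplicity x y : nat := #|[set e | joins e x y]|.

Definition connected_by T : Prop :=
  forall x y, connect (fun u v => [exists e in T, joins e u v]) x y.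

(* A cycle v_0 e_0 v_1 e_1 ... v_l e_l v_0, with distinct vertices and distinct
   edges, is given by the sequence of the pairs (v_j, e_j). Two parallel edges
   form a cycle of length 2, and a loop is a cycle of length 1. *)
Definition is_cycle (s : seq (vertex G * edge G)) : bool :=
  [&& s != [::], uniq (unzip1 s), uniq (unzip2 s)
    & path.cycle (fun p q => joins p.2 p.1 q.1) s].

Definition acyclic T : Prop :=
  forall s, is_cycle s -> ~ {subset unzip2 s <= T}.

Definition spanning_tree T : Prop := connected_by T /\ acyclic T.

Definition num_spanning_trees : nat :=
  #|[set T : {set edge G} | `[< spanning_tree T >]]|.

Variable R : pzRingType.

Definition laplacian (f : vertex G -> R) (x : vertex G) : R :=
  \sum_(y : vertex G) (f x - f y) *+ multiplicity x y.

(* Matrix of [laplacian] in the basis of indicator functions of vertices. *)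
Definition laplacian_mx : 'M[R]_#|vertex G| :=
  \matrix_(i, j) laplacian (fun z => (z == enum_val j)%:R) (enum_val i).

End Multigraph.

Arguments laplacian_mx : clear implicits.

(* The circulant graph on Z/NZ with jumps c_1, ..., c_r, for N >= 2 (the type
   'Z_N is Z/2Z when N < 2). The edge (v, i) joins v to v + c_i, which accounts
   for the neighbour v + c_i of v and for the neighbour v - c_i of v, the latter
   through the edge (v - c_i, i). Hence the graph is 2r-regular; in particular
   when c_i = N / 2, the edges (v, i) and (v + c_i, i) are parallel. *)
Definition circulant (N : nat) (c : seq nat) : multigraph :=
  @Multigraph 'Z_N ('Z_N * 'I_(size c))%type
    (fun e => (e.1, e.1 + (nth 0%N c e.2)%:R)).

Definition mu (R : realType) (d beta : nat) (gamma : (d - 1).-tuple nat)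
    (k : nat) : R :=
  2 * (d - 1)%:R
  - 2 * \sum_(m < d - 1) cos (2 * pi * k%:R * (tnth gamma m)%:R / beta%:R).
Arguments mu R {d} beta gamma k.

(* Main.v *)
(* Choose at each vertex either nothing or an incident edge with its far end,
   and expand det(X + L) row by row along these choices. By the Leibniz formula
   a choice without cycle contributes X^r, where r is its number of roots; a
   choice with a cycle contributes 0, because the indicator of the vertices that
   reach no root is in the kernel. The acyclic choices with a single root are
   the spanning trees with a marked vertex, so N * tau is the coefficient of X
   in det(X + L), that is, the product of the eigenvalues of index k <> 0.

   A Vandermonde matrix in a primitive N-th root of unity diagonalizes a
   circulant Laplacian. With N = beta n and jumps 1, gamma_m n, the eigenvalue
   of index k is 2 - 2 cos(2 pi k / N) + mu_k, and mu_k only depends on k mod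
   beta. In each residue class l mod beta the product is evaluated by
     prod_(j < n) (a + 1/a - 2 cos(t + 2 pi j / n)) = a^n + a^-n - 2 cos(n t),
   which follows from factoring x^n - y^n; the class l = 0, without k = 0, gives
   prod_(0 < j < n) (2 - 2 cos(2 pi j / n)) = n^2. *)
Require Import Defs.
From HB Require Import structures.
From mathcomp Require Import all_boot all_order all_algebra.
From mathcomp Require Import all_fingroup complex ring lra.
From mathcomp Require Import all_classical all_reals all_analysis.

Set Implicit Arguments.
Unset Strict Implicit.
Unset Printing Implicit Defensive.

Import Order.TTheory GRing.Theory Num.Theory.
Local Open Scope ring_scope.

(** * Spanning trees as parent maps *)

Section Arborescences.
Variable G : multigraph.
Implicit Types (r u v w x y z : vertex G) (e : edge G) (T : {set edge G}).

Lemma joinsC e x y : joins e x y = joins e y x.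
Proof. by rewrite /joins orbC. Qed.

Lemma joins_inj e x y z w : joins e x y -> joins e z w ->
  (z = x /\ w = y) \/ (z = y /\ w = x).
Proof.
rewrite /joins; case: (ends e) => a b; rewrite !xpair_eqE.
by move=> /orP[]/andP[/eqP-> /eqP->] /orP[]/andP[/eqP-> /eqP->]; auto.
Qed.

(* [Some (e, w)] at v means that w is the parent of v, through the edge e; [None]
   marks a root. *)
Definition parent_map := {ffun vertex G -> option (edge G * vertex G)}.
Implicit Type f : parent_map.

(** A root is its own parent, so that iteration stays there. *)
Definition parent f v := if f v is Some p then p.2 else v.

Definition incident f :=
  [forall v, if f v is Some p then joins p.1 v p.2 else true].

(** This is the absence of cycles: on a finite vertex set, a parent chain that meets no root ends up
    in a cycle. *)
Definition rooted f :=
  [forall v, exists r, (f r == None) && fconnect (parent f) v r].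

Definition arborescence r f :=
  [&& incident f, [forall v, (f v == None) == (v == r)]
    & [forall v, fconnect (parent f) v r]].

Definition edges_of f : {set edge G} :=
  [set e | [exists v, omap fst (f v) == Some e]].

Lemma edges_ofP f e :
  reflect (exists v w, f v = Some (e, w)) (e \in edges_of f).
Proof.
rewrite inE; apply: (iffP existsP) => [[v]|[v [w fv]]]; last first.
  by exists v; rewrite fv.
by case fv: (f v) => [[e' w]|] //= /eqP[<-]; exists v, w.
Qed.

Definition adj T x y := [exists e in T, joins e x y].

Lemma adj_sym T : symmetric (adj T).
Proof. by move=> x y; apply: eq_existsb => e; rewrite joinsC. Qed.

Lemma arborescence_root r f v : arborescence r f -> (f v = None) <-> v = r.
Proof.
move=> /and3P[_ /forallP/(_ v)/eqP fE _].
by split=> /eqP fv; apply/eqP; move: fv; rewrite fE.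
Qed.

Lemma arborescence_joins r f v e w : arborescence r f ->
  f v = Some (e, w) -> joins e v w.
Proof. by move=> /and3P[/forallP/(_ v) + _ _] fv; rewrite fv. Qed.

Definition depth r f v := findex (parent f) v r.

Lemma depth_parent r f v e w : arborescence r f -> f v = Some (e, w) ->
  depth r f v = (depth r f w).+1.
Proof.
move=> Af fv; have /and3P[_ _ /forallP/(_ v) vr] := Af.
rewrite /depth (fconnect_findex vr) /parent ?fv //.
by apply/eqP => rv; have /(arborescence_root _ Af) := esym rv; rewrite fv.
Qed.

Lemma arborescence_connected r f : arborescence r f ->
  connected_by (edges_of f).
Proof.
move=> Af; have conn_r x : connect (adj (edges_of f)) x r.
  have [k le_k] := ubnP (depth r f x); elim: k x le_k => // k IHk x.
  case fx: (f x) => [[e w]|]; last first.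
    by have /(arborescence_root _ Af) -> := fx; rewrite connect0.
  rewrite (depth_parent Af fx) ltnS => /IHk; apply/connect_trans/connect1.
  apply/existsP; exists e; rewrite (arborescence_joins Af fx) andbT.
  by apply/edges_ofP; exists x, w.
move=> x y; apply: (connect_trans (conn_r x)).
by rewrite (sym_connect_sym (adj_sym _)); apply: conn_r.
Qed.

(* At a deepest vertex of a cycle, both cycle edges would be the edge to its
   parent. *)
Lemma arborescence_acyclic r f : arborescence r f -> acyclic (edges_of f).
Proof.
move=> Af s cyc_s sub_s.
(* A tree edge from v to a vertex that is not deeper can only be the parent edge of v. *)
have up_edge e v u : e \in edges_of f -> joins e v u ->
    (depth r f u <= depth r f v)%N -> f v = Some (e, u).
  move=> /edges_ofP[c [p fc]] jvu le_d.
  have [[vc up]|[vp uc]] := joins_inj (arborescence_joins Af fc) jvu.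
    by rewrite vc up.
  by move: le_d; rewrite vp uc (depth_parent Af fc) ltnn.
have [p0 p0s]: exists p, p \in s.
  by case/and4P: (cyc_s); case: (s) => // p s' *; exists p; rewrite mem_head.
pose d (q : vertex G * edge G) := depth r f q.1.
have [p ps p_max] : exists2 p, p \in s & forall q, q \in s -> (d q <= d p)%N.
  by case: (@arg_maxnP _ p0 [in s] d p0s) => p ps p_max; exists p.
have [i s' def_s] := rot_to ps.
have subs' q : q \in p :: s' -> (q.2 \in edges_of f) /\ (d q <= d p)%N.
  rewrite -def_s mem_rot => qs; split; last exact: p_max.
  by apply: sub_s; apply: map_f.
case/and4P: cyc_s => _ _ uniq2 cyc.
have {}uniq2 : uniq (unzip2 (p :: s')).
  by rewrite -def_s /unzip2 map_rot rot_uniq.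
have {cyc} : path.cycle (fun p q => joins p.2 p.1 q.1) (p :: s').
  by rewrite -def_s rot_cycle.
have [ep dp] := subs' p (mem_head _ _).
(* A loop would make its vertex its own parent, hence deeper than itself. *)
case: s' => [|q s'] in uniq2 subs' {def_s} *.
  rewrite /= andbT => jp; have := depth_parent Af (up_edge _ _ _ ep jp dp).
  by move/eqP; rewrite -[X in X == _]addn0 -addn1 eqn_add2l.
rewrite (cycle_path p) /= => /and3P[jl jp _].
have [eq dq] : (q.2 \in edges_of f) /\ (d q <= d p)%N.
  by apply: subs'; rewrite !inE eqxx orbT.
have [el dl] : ((last q s').2 \in edges_of f) /\ (d (last q s') <= d p)%N.
  by apply: subs'; rewrite inE mem_last orbT.
have fp := up_edge _ _ _ ep jp dq.
have := up_edge _ _ _ el; rewrite joinsC in jl => /(_ _ _ jl dl).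
rewrite fp => -[e_eq _]; have /andP[/negP[]] :
    (p.2 \notin unzip2 (q :: s')) && uniq (unzip2 (q :: s')) := uniq2.
by apply/mapP; exists (last q s'); rewrite ?mem_last.
Qed.

(** Induction on depth in f. If f sends x to w through e, then e is also a parent edge of g, at x or
    at w. In the second case the induction hypothesis at w makes x the f-parent of w, and each of x,
    w would be deeper than the other. *)
Lemma arborescence_inj r f g : arborescence r f -> arborescence r g ->
  edges_of f = edges_of g -> f = g.
Proof.
move=> Af Ag efg; apply/ffunP => x.
have [k le_k] := ubnP (depth r f x); elim: k x le_k => // k IHk x.
case fx: (f x) => [[e w]|]; last first.
  by have /(arborescence_root _ Af)/(arborescence_root _ Ag) -> := fx.
have df := depth_parent Af fx; rewrite df ltnS => /IHk fgw.
have /edges_ofP[c [z gc]] : e \in edges_of g.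
  by rewrite -efg; apply/edges_ofP; exists x, w.
have := joins_inj (arborescence_joins Af fx) (arborescence_joins Ag gc).
move=> [[cx zw]|[cw zx]]; first by rewrite -zw -cx.
move: gc; rewrite cw zx -fgw => /(depth_parent Af) dw.
by move: df; rewrite dw => /eqP; rewrite -addn2 -[X in X == _]addn0 eqn_add2l.
Qed.

(** The edges picked along a simple path are distinct, because x lies on the first edge and on no
    later one. The last clause leaves the edge at the end vertex free, so that any edge can close
    the path into a cycle. *)
Lemma uniq_path_edges T x p : path (adj T) x p -> uniq (x :: p) ->
  exists s : seq (vertex G * edge G),
  [/\ unzip1 s = belast x p, uniq (unzip2 s), {subset unzip2 s <= T},
      forall q, q \in s -> exists2 z, joins q.2 q.1 z &
        (q.1 \in x :: p) && (z \in x :: p)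
    & forall e, sorted (fun p q => joins p.2 p.1 q.1) (rcons s (last x p, e))].
Proof.
elim: p x => [|y p IHp] x; first by exists [::]; split.
move=> /= /andP[/exists_inP[e eT jxy] pth] /andP[x_notin uniq_yp].
have [s [s1 s2 sT s_ends s_path]] := IHp y pth uniq_yp.
exists ((x, e) :: s); split=> /=.
- by rewrite s1.
- rewrite s2 andbT; apply/negP => /mapP[q /s_ends[z jz /andP[q1 z1]] eq].
  rewrite -eq in jz; have [[qx _]|[_ zx]] := joins_inj jxy jz.
    by rewrite -qx q1 in x_notin.
  by rewrite -zx z1 in x_notin.
- by move=> e'; rewrite inE => /predU1P[->|/sT].
- move=> q; rewrite inE => /predU1P[->|/s_ends[z jz /andP[q1 z1]]] /=.
    by exists y => //; rewrite !inE !eqxx orbT.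
  by exists z; rewrite // !(in_cons x) q1 z1 !orbT.
move=> e'; have := s_path e'.
case: s s1 {s2 sT s_ends s_path} => [|q s] /= s1.
  by case: p s1 {IHp pth x_notin uniq_yp} => // _; rewrite /= jxy.
move=> ->; rewrite andbT.
by case: p s1 {IHp pth x_notin uniq_yp} => //= z p [-> _].
Qed.

(** An edge of T outside T' would close a simple T'-path between its ends into a cycle of T. *)
Lemma acyclic_sub_eq T T' : acyclic T -> T' \subset T -> connected_by T' ->
  T' = T.
Proof.
move=> acT sT'T conT'; apply/eqP; rewrite finset.eqEsubset sT'T /=.
apply/fintype.subsetP => e eT; apply/negPn/negP => eT'.
case def_e: (ends e) => [x y].
have /connectP[p0 pth0 y_last0] := conT' x y.
have := y_last0; case/shortenP: pth0 => p pth uniq_p _ y_last {p0 y_last0}.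
have [s [s1 s2 sT s_ends s_path]] := uniq_path_edges pth uniq_p.
have e_notin : e \notin unzip2 s by apply: contra eT'; apply: sT.
apply: (acT (rcons s (y, e))); last first.
  move=> e'; rewrite /unzip2 map_rcons mem_rcons inE => /predU1P[->//|/sT].
  exact: (fintype.subsetP sT'T).
have je : joins e y x by rewrite /joins def_e eqxx orbT.
apply/and4P; split; first by case: (s).
- by rewrite /unzip1 map_rcons -/(unzip1 s) s1 y_last -lastI.
- by rewrite /unzip2 map_rcons rcons_uniq -/(unzip2 s) s2 e_notin.
have := s_path e; rewrite -y_last.
(* With an empty path the extra edge is a loop, itself a cycle of length 1. *)
case: s s1 {s2 sT s_ends s_path e_notin} => [|q s] s1 /=.
  case: p s1 {pth uniq_p} y_last => //= _ yx _.
  by rewrite yx in je *; rewrite je.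
move=> pth_s; rewrite rcons_path pth_s last_rcons /=.
by case: p s1 {pth uniq_p y_last} => //= z p [-> _].
Qed.

(** Breadth-first tree: every vertex other than r picks an edge of T towards a vertex strictly
    closer to r. *)
Lemma arborescence_exists r T : connected_by T ->
  exists2 f, arborescence r f & edges_of f \subset T.
Proof.
move=> conT.
have ex_path x : exists k, [exists p : k.-tuple (vertex G),
    path (adj T) x p && (last x p == r)].
  have /connectP[p pth ->] := conT x r; exists (size p).
  by apply/existsP; exists (in_tuple p); rewrite pth eqxx.
pose dist x := ex_minn (ex_path x).
have step x : x != r ->
    exists q : edge G * vertex G,
      [&& q.1 \in T, joins q.1 x q.2 & (dist q.2 < dist x)%N].
  move=> x_r; rewrite {2}/dist; case: ex_minnP => k.
  move=> /existsP[[p /= /eqP size_p] /andP[pth last_p]] _.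
  case: p => [|y p] /= in size_p pth last_p *; first by rewrite last_p in x_r.
  case/andP: pth => /exists_inP[e eT jxy] pth.
  exists (e, y); rewrite /= eT jxy -size_p ltnS /dist.
  case: ex_minnP => m _; apply; apply/existsP; exists (in_tuple p).
  by rewrite pth last_p.
pose f : parent_map := [ffun x => if x == r then None else
  [pick q | [&& q.1 \in T, joins q.1 x q.2 & (dist q.2 < dist x)%N]]].
have f_some x : x != r -> exists q,
    [/\ f x = Some q, q.1 \in T, joins q.1 x q.2 & (dist q.2 < dist x)%N].
  move=> x_r; rewrite ffunE (negPf x_r); case: pickP => [q /and3P[]|none].
    by exists q.
  by have [q] := step x x_r; rewrite none.
have f_r : f r = None by rewrite ffunE eqxx.
exists f.
  apply/and3P; split; apply/forallP => x; have [->|x_r] := eqVneq x r;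
    rewrite ?f_r ?eqxx ?connect0 //.
  - by have [q [->]] := f_some x x_r.
  - by have [q [->]] := f_some x x_r.
  have [k le_k] := ubnP (dist x); elim: k x x_r le_k => // k IHk x x_r le_k.
  have [q [fx _ _ lt_d]] := f_some x x_r.
  have px : parent f x = q.2 by rewrite /parent fx.
  have [q_r|q_r] := eqVneq q.2 r; first by rewrite -q_r -px fconnect1.
  apply: connect_trans (fconnect1 _ _) _; rewrite px; apply: IHk => //.
  by apply: leq_trans lt_d _.
apply/fintype.subsetP => e /edges_ofP[x [w fx]].
have [xr|/f_some[q [fx' + _ _]]] := eqVneq x r; first by rewrite xr f_r in fx.
by move: fx; rewrite fx' => -[->].
Qed.

(** For a fixed root, [edges_of] is a bijection onto spanning trees: a tree has just one orientation
    towards r. Surjectivity takes an arborescence inside the tree, which must fill it by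
    [acyclic_sub_eq]. *)
Lemma card_arborescences r :
  #|[set f | arborescence r f]| = num_spanning_trees G.
Proof.
rewrite /num_spanning_trees.
have <- : edges_of @: [set f | arborescence r f]
    = [set T | `[< spanning_tree T >]].
  apply/setP => T; rewrite inE; apply/imsetP/asboolP => [[f]|[conT acT]].
    rewrite inE => Af ->; split; first exact: arborescence_connected Af.
    exact: arborescence_acyclic Af.
  have [f Af sfT] := arborescence_exists r conT.
  exists f; rewrite ?inE //; apply/esym/acyclic_sub_eq => //.
  exact: arborescence_connected Af.
rewrite card_in_imset // => f g; rewrite !inE; exact: arborescence_inj.
Qed.

End Arborescences.

(** * Forest expansion of the characteristic polynomial *)

(** Multilinearity in the rows: f records which summand is taken in each row. *)
Lemma det_row_sum (R : comNzRingType) n (C : finType)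
    (F : 'I_n -> C -> 'I_n -> R) :
  \det (\matrix_(i, j) \sum_c F i c j)
    = \sum_(f : {ffun 'I_n -> C}) \det (\matrix_(i, j) F i (f i) j).
Proof.
rewrite /determinant exchange_big /=; apply: eq_bigr => s _.
rewrite -big_distrr /=; congr (_ * _).
rewrite (eq_bigr (fun i => \sum_c F i c (s i))) => [|i _]; last by rewrite mxE.
rewrite bigA_distr_bigA; apply: eq_bigr => f _.
by apply: eq_bigr => i _; rewrite mxE.
Qed.

Lemma big_option (R : Type) (idx : R) (op : Monoid.com_law idx) (T : finType)
    (F : option T -> R) :
  \big[op/idx]_c F c = op (F None) (\big[op/idx]_x F (Some x)).
Proof.
rewrite (bigD1 None) //=; congr (op _ _).
rewrite (reindex_omap (@Some T) id) => [|[x|]] //=.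
by apply: eq_bigl => x; rewrite eqxx.
Qed.

Section MatrixForest.
Variables (G : multigraph) (R : idomainType).
Implicit Types (f : parent_map G).
Local Notation L := (laplacian_mx G R).
Local Notation V := (vertex G).

Definition roots_of f : {set V} := [set v | f v == None].

(** Row v of X + L is the sum of these rows over all choices c; a pair whose edge does not join v to
    its second component contributes a zero row. *)
Definition choice_entry (v : V) (c : option (edge G * V)) (u : V) : {poly R} :=
  if c is Some p then ((v == u)%:R - (p.2 == u)%:R) *+ joins p.1 v p.2
  else 'X *+ (v == u).

Definition choice_mx f : 'M[{poly R}]_#|V| :=
  \matrix_(i, j) choice_entry (enum_val i) (f (enum_val i)) (enum_val j).

Lemma char_poly_mx_laplacian :
  char_poly_mx (- L)
    = \matrix_(i, j) \sum_c choice_entry (enum_val i) c (enum_val j).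
Proof.
apply/matrixP => i j; rewrite !mxE big_option /= (inj_eq enum_val_inj).
congr (_ + _); rewrite -polyCN opprK /laplacian rmorph_sum /=.
rewrite (eq_bigr (fun y => \sum_(e : edge G)
    ((i == j)%:R - (y == enum_val j)%:R : {poly R}) *+ joins e (enum_val i) y)).
  by rewrite exchange_big pair_bigA /=; apply: eq_bigr.
move=> y _; rewrite /multiplicity polyCMn polyCB !polyC_natr.
rewrite (inj_eq enum_val_inj) sumrMnr; congr (_ *+ _).
rewrite -sum1_card big_mkcond; apply: eq_bigr => e _.
by rewrite inE; case: joins.
Qed.

Lemma det_choice_mx_Nincident f : ~~ incident f -> \det (choice_mx f) = 0.
Proof.
case/forallPn => v; case fv: (f v) => [p|] // /negPf jp.
rewrite (expand_det_row _ (enum_rank v)) big1 // => j _.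
by rewrite mxE enum_rankK fv /= jp mulr0n mul0r.
Qed.

(* The indicator of the vertices that reach no root is killed by the matrix. *)
Lemma det_choice_mx_Nrooted f : ~~ rooted f -> \det (choice_mx f) = 0.
Proof.
case/forallPn => v0 v0_unrooted.
pose reach v := [exists r, (f r == None) && fconnect (parent f) v r].
pose u : 'cV[{poly R}]_#|V| := \col_i (~~ reach (enum_val i))%:R.
have u0 : choice_mx f *m u = 0.
  apply/colP => i; rewrite !mxE; set v := enum_val i.
  rewrite (reindex enum_rank) /=; last by apply: onW_bij; apply: enum_rank_bij.
  rewrite (eq_bigr (fun y => choice_entry v (f v) y * (~~ reach y)%:R));
    last by move=> y _; rewrite !mxE !enum_rankK.
  have sum_delta y : \sum_z (y == z)%:R * (~~ reach z)%:R
      = (~~ reach y)%:R :> {poly R}.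
    rewrite (bigD1 y) //= eqxx mul1r big1 ?addr0 // => z /negPf.
    by rewrite eq_sym => ->; rewrite mul0r.
  case fv: (f v) => [p|] /=.
    rewrite (eq_bigr (fun z => ((v == z)%:R * (~~ reach z)%:R
      - (p.2 == z)%:R * (~~ reach z)%:R) *+ joins p.1 v p.2)); last first.
      by move=> z _; rewrite -mulrBl mulrnAl.
    rewrite sumrMnl sumrB !sum_delta.
    suff -> : reach v = reach p.2 by rewrite subrr mul0rn.
    have nv : parent f v = p.2 by rewrite /parent fv.
    apply: eq_existsb => r; apply: andb_id2l => /eqP fr.
    rewrite -nv; apply/idP/idP => [vr|]; last first.
      exact/connect_trans/fconnect1.
    (* Zero steps are excluded since v is not a root, so a path from v to r starts with its
       parent. *)
    have /iter_findex := vr; case def_k: findex => [|k] /=.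
      by move=> vr'; rewrite vr' fr in fv.
    by rewrite -iterS iterSr => <-; apply: fconnect_iter.
  rewrite (eq_bigr (fun z => 'X * ((v == z)%:R * (~~ reach z)%:R))); last first.
    by move=> z _; rewrite mulrA; congr (_ * _); rewrite mulr_natr.
  rewrite -mulr_sumr sum_delta.
  suff -> : reach v by rewrite mulr0.
  by apply/existsP; exists v; rewrite fv eqxx connect0.
(* Multiplying by the adjugate turns the kernel vector into det * u = 0, and u is 1 at the unrooted
   vertex. *)
have /colP/(_ (enum_rank v0)) : \adj (choice_mx f) *m (choice_mx f *m u) = 0.
  by rewrite u0 mulmx0.
rewrite mulmxA mul_adj_mx mul_scalar_mx !mxE enum_rankK.
by rewrite /reach v0_unrooted mulr1.
Qed.

(* In the Leibniz expansion, a vertex moved by a permutation with nonzero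
   contribution has all its ancestors moved, hence is not rooted. *)
Lemma det_choice_mx_forest f : incident f -> rooted f ->
  \det (choice_mx f) = 'X^#|roots_of f|.
Proof.
move=> /forallP incf /forallP rootf.
have entry v u : choice_entry v (f v) u =
    if f v is Some p then (v == u)%:R - (p.2 == u)%:R else 'X *+ (v == u).
  by have := incf v; case: (f v) => [p|] //= ->.
rewrite /determinant (bigD1 1%g) //= odd_perm1 expr0 mul1r.
rewrite [X in _ + X]big1 ?addr0 => [|s].
  rewrite (reindex enum_rank) /=; last by apply: onW_bij; apply: enum_rank_bij.
  rewrite (eq_bigr (fun v => if v \in roots_of f then 'X else 1)).
    by rewrite -big_mkcond /= prodr_const.
  move=> v _; rewrite perm1 mxE enum_rankK entry inE.
  case fv: (f v) => [p|] /=; rewrite eqxx // -[RHS]subr0; congr (_ - _).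
  suff /negPf -> : p.2 != v by [].
  apply/eqP => pv; have /existsP[r /andP[/eqP fr /iter_findex]] := rootf v.
  have -> k : iter k (parent f) v = v.
    by elim: k => //= k ->; rewrite /parent fv.
  by move=> vr; rewrite -vr fv in fr.
move=> s_neq1; apply/eqP; rewrite mulf_eq0; apply/orP; right.
apply: contraNT s_neq1; rewrite prodf_seq_neq0 => /allP nz.
have {}nz i : choice_entry (enum_val i) (f (enum_val i)) (enum_val (s i)) != 0.
  by have := nz i (mem_index_enum i); rewrite mxE.
apply/eqP/permP => i; rewrite perm1; apply/eqP/negPn/negP => si.
(* Off the diagonal, a nonzero entry forces s to send a vertex to its parent; injectivity of s keeps
   every iterate moved. *)
have iter_s k : iter k (parent f) (enum_val i) = enum_val ((s ^+ k)%g i)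
    /\ s ((s ^+ k)%g i) != (s ^+ k)%g i.
  elim: k => [|k [IHk IHs]]; first by rewrite expg0 perm1.
  have sk : (s ^+ k.+1)%g i = s ((s ^+ k)%g i) by rewrite expgSr permM.
  rewrite sk (inj_eq perm_inj); split=> //=.
  rewrite IHk; set j := (s ^+ k)%g i in IHs *.
  have := nz j; rewrite entry /parent (inj_eq enum_val_inj).
  rewrite [j == _]eq_sym (negPf IHs).
  case: (f _) => [p|]; last by rewrite mulr0n eqxx.
  by case: (p.2 =P enum_val (s j)) => // _; rewrite subr0 eqxx.
(* Some iterate is a root, whose row vanishes off the diagonal although s moves it. *)
have /existsP[r /andP[/eqP fr /iter_findex]] := rootf (enum_val i).
have [-> sj] := iter_s (findex (parent f) (enum_val i) r).
set j := (s ^+ _)%g i in sj * => rE; have := nz j.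
rewrite entry {1}rE fr (inj_eq enum_val_inj) [j == _]eq_sym (negPf sj) mulr0n.
by rewrite eqxx.
Qed.

Lemma char_poly_laplacian_forests :
  char_poly (- L)
    = \sum_(f : parent_map G | incident f && rooted f) 'X^#|roots_of f|.
Proof.
rewrite /char_poly char_poly_mx_laplacian det_row_sum.
pose h (f : parent_map G) := [ffun i : 'I_#|V| => f (enum_val i)].
pose h' (g : {ffun 'I_#|V| -> option (edge G * V)}) : parent_map G :=
  [ffun v => g (enum_rank v)].
rewrite (reindex h) /=; last first.
  by exists h' => f _; apply/ffunP => x; rewrite !ffunE ?enum_rankK ?enum_valK.
rewrite [RHS]big_mkcond; apply: eq_bigr => f _.
have -> : \matrix_(i, j) choice_entry (enum_val i) (h f i) (enum_val j)
    = choice_mx f by apply/matrixP => i j; rewrite !mxE ffunE.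
have [incf|] := boolP (incident f); last exact: det_choice_mx_Nincident.
have [rootf|] := boolP (rooted f); last exact: det_choice_mx_Nrooted.
exact: det_choice_mx_forest.
Qed.

(** At most one term of the sum is nonzero, at the unique root. This lets one-rooted forests be
    counted root by root. *)
Lemma single_root_arborescence f :
  (incident f && rooted f && (#|roots_of f| == 1%N) : nat)
    = (\sum_r arborescence r f)%N.
Proof.
have arbE r : arborescence r f
    = [&& incident f, rooted f & roots_of f == [set r]].
  apply/idP/idP => [Af|/and3P[incf /forallP rootf /eqP rf]].
    have /and3P[incf rf /forallP conn] := Af; apply/and3P; split=> //.
      apply/forallP => v; apply/existsP; exists r; rewrite conn andbT.
      by apply/eqP/(arborescence_root _ Af).
    by apply/eqP/setP => v; rewrite !inE; apply/eqP/eqP;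
       move/(arborescence_root _ Af).
  have root_r v : (f v == None) = (v == r).
    by have /setP/(_ v) := rf; rewrite !inE.
  apply/and3P; split=> //; first by apply/forallP => v; rewrite root_r.
  by apply/forallP => v; have /existsP[w /andP[]] := rootf v;
    rewrite root_r => /eqP ->.
case: (boolP (_ && _ && _)) => [/andP[/andP[incf rootf] /cards1P[r rf]]|].
  rewrite (bigD1 r) //= arbE incf rootf rf eqxx big1 // => w wr.
  by rewrite arbE rf (inj_eq set1_inj) eq_sym (negPf wr) !andbF.
move=> not1; rewrite big1 // => r _; rewrite arbE; apply/eqP; rewrite eqb0.
by apply: contra not1 => /and3P[-> -> /eqP ->]; rewrite cards1.
Qed.

(** Only forests with one root contribute to the coefficient of X, and each vertex is the root of as
    many of them as there are spanning trees. *)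
Theorem matrix_tree :
  (char_poly (- L))`_1 = (num_spanning_trees G * #|V|)%:R.
Proof.
rewrite char_poly_laplacian_forests coef_sum.
rewrite (eq_bigr (fun f : parent_map G => (#|roots_of f| == 1%N)%:R));
  last by move=> f _; rewrite coefXn eq_sym.
rewrite big_mkcond (eq_bigr (fun f : parent_map G =>
    (\sum_r arborescence r f)%N%:R)); last first.
  by move=> f _; rewrite -single_root_arborescence; case: (_ && rooted f).
rewrite -natr_sum exchange_big /=; congr _%:R.
rewrite (eq_bigr (fun=> num_spanning_trees G)).
  by rewrite sum_nat_const mulnC.
by move=> r _; rewrite -(card_arborescences r) -sum1dep_card [RHS]big_mkcond.
Qed.

End MatrixForest.

(** * Spectrum of circulant graphs *)

(** Taking determinants in (X - A) W = W (X - D), the nonzero constant det W cancels. *)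
Lemma char_poly_diagonalized (F : fieldType) n (A W : 'M[F]_n) (d : 'rV_n) :
  W \in unitmx -> A *m W = W *m diag_mx d ->
  char_poly A = \prod_i ('X - (d 0 i)%:P).
Proof.
rewrite unitmxE unitfE => detW AW.
have -> : \prod_i ('X - (d 0 i)%:P) = char_poly (diag_mx d).
  rewrite char_poly_trig; last exact: diag_mx_is_trig.
  by apply: eq_bigr => i _; rewrite mxE eqxx.
pose WX := map_mx polyC W.
have : char_poly_mx A *m WX = WX *m char_poly_mx (diag_mx d).
  rewrite /char_poly_mx mulmxBl mulmxBr mul_scalar_mx mul_mx_scalar.
  by rewrite -!map_mxM AW.
move/(congr1 determinant); rewrite !det_mulmx mulrC => /mulfI; apply.
by rewrite /WX det_map_mx polyC_eq0.
Qed.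

Lemma laplacian_mxE (H : multigraph) (R : pzRingType) (g : vertex H -> R) i :
  \sum_j laplacian_mx H R i j * g (enum_val j) = laplacian g (enum_val i).
Proof.
rewrite (reindex enum_rank) /=; last by apply: onW_bij; apply: enum_rank_bij.
rewrite /laplacian; set x := enum_val i.
rewrite (eq_bigr (fun z => \sum_y
   (((x == z)%:R - (y == z)%:R) * g z) *+ multiplicity x y)); last first.
  move=> z _; rewrite !mxE enum_rankK mulr_suml.
  by apply: eq_bigr => y _; rewrite mulrnAl.
rewrite exchange_big /=; apply: eq_bigr => y _; rewrite sumrMnl.
congr (_ *+ _).
rewrite (eq_bigr (fun z => (x == z)%:R * g z - (y == z)%:R * g z)); last first.
  by move=> z _; rewrite mulrBl.
have sum_delta w : \sum_z (w == z)%:R * g z = g w.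
  rewrite (bigD1 w) //= eqxx mul1r big1 ?addr0 // => z /negPf.
  by rewrite eq_sym => ->; rewrite mul0r.
by rewrite sumrB !sum_delta.
Qed.

Section Circulant.
Variables (N : nat) (c : seq nat).
Hypothesis N_gt1 : (1 < N)%N.
Local Notation G := (circulant N c).

Lemma card_Z : #|'Z_N| = N.
Proof. by rewrite card_ord Zp_cast. Qed.

Lemma laplacian_circulant (R : pzRingType) (g : 'Z_N -> R) x :
  laplacian (G := G) g x = \sum_(i < size c)
    ((g x - g (x + (nth 0%N c i)%:R)) + (g x - g (x - (nth 0%N c i)%:R))).
Proof.
pose a (i : 'I_(size c)) : 'Z_N := (nth 0%N c i)%:R.
rewrite /laplacian.
rewrite (eq_bigr (fun y => \sum_(i < size c) \sum_(v : 'Z_N)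
   ((g x - g y) *+ ((v == x) && (y == v + a i))
     + (g x - g y) *+ ((v == y) && (x == v + a i))))).
  rewrite exchange_big /=; apply: eq_bigr => i _.
  rewrite exchange_big /= (eq_bigr (fun v =>
    (\sum_y (g x - g y) *+ ((v == x) && (y == v + a i)))
    + (\sum_y (g x - g y) *+ ((v == y) && (x == v + a i))))); last first.
    by move=> v _; rewrite big_split.
  rewrite big_split /=; congr (_ + _).
    rewrite (bigD1 x) //= (bigD1 (x + a i)) //= !eqxx mulr1n !big1 ?addr0 //.
      by move=> v /negPf vx; rewrite big1 // => y _; rewrite vx mulr0n.
    by move=> y /negPf yx; rewrite yx andbF mulr0n.
  rewrite (bigD1 (x - a i)) //= (bigD1 (x - a i)) //=.
  rewrite subrK !eqxx mulr1n !big1 ?addr0 //.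
    move=> v vx; rewrite big1 // => y _; rewrite -subr_eq.
    by rewrite [x - a i == v]eq_sym (negPf vx) andbF.
  by move=> y; rewrite eq_sym => /negPf ->; rewrite mulr0n.
(* Edges from x to itself do not matter, as g x - g y vanishes. For x different from y, the two ways
   an edge (v, i) can join them exclude each other, so the disjunction in [joins] becomes a sum. *)
move=> y _; have [->|xy] := eqVneq x y.
  rewrite subrr mul0rn big1 // => i _; rewrite big1 // => v _.
  by rewrite !mul0rn addr0.
rewrite /multiplicity -sum1_card -sumrMnr big_mkcond /=.
rewrite exchange_big pair_bigA /=; apply: eq_bigr => -[v i] _.
rewrite inE /joins /= !xpair_eqE -/(a i) ![_ == v + a i]eq_sym.
rewrite -mulrnDr; case: (v =P x) => [->|_] /=; last first.
  by rewrite add0n; case: (_ && _).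
by rewrite (negPf xy) /= addn0 orbF; case: (_ == _).
Qed.

(** The characters x -> w^(k x) are eigenvectors; they form the columns of the Vandermonde matrix,
    invertible since the powers of w below N are distinct. *)
Lemma char_poly_circulant_root (F : fieldType) (w a : F) :
  N.-primitive_root w ->
  char_poly (a *: laplacian_mx G F)
    = \prod_(0 <= k < N) ('X - (a * \sum_(i < size c)
        (2 - (w ^+ (k * nth 0%N c i) + (w ^+ (k * nth 0%N c i))^-1)))%:P).
Proof.
move=> prim_w.
pose ev k := a * \sum_(i < size c)
        (2 - (w ^+ (k * nth 0%N c i) + (w ^+ (k * nth 0%N c i))^-1)).
have w_neq0 : w != 0 by rewrite (prim_root_eq0 prim_w) -lt0n ltnW.
pose W := Vandermonde #|vertex G| (\row_(j < #|vertex G|) w ^+ j).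
pose d := \row_(j < #|vertex G|) ev j.
(* The representative of x + m is determined only mod N, which is harmless since w^N = 1. *)
have addE (x : 'Z_N) m k :
    w ^+ (k * (x + m%:R : 'Z_N)%R) = w ^+ (k * x) * w ^+ (k * m).
  rewrite -exprD -mulnDr; apply/eqP.
  rewrite (eq_prim_root_expr prim_w) -modnMmr.
  have -> : (x + m%:R : 'Z_N) = ((x + m) %% N)%N :> nat.
    by rewrite Zp_nat /= modnDmr; congr (_ %% _)%N; apply: Zp_cast.
  by rewrite modn_mod modnMmr.
rewrite (@char_poly_diagonalized _ _ _ W d).
- rewrite -[in RHS]card_Z big_mkord; apply: eq_bigr => i _.
  by rewrite /d mxE.
- rewrite unitmxE unitfE det_Vandermonde.
  apply/prodf_neq0 => i _; apply/prodf_neq0 => j ij.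
  rewrite !mxE subr_eq0 (eq_prim_root_expr prim_w).
  have lt_N (k : 'I_#|vertex G|) : (k < N)%N by rewrite -[X in (_ < X)%N]card_Z.
  by rewrite !modn_small // gtn_eqF.
apply/matrixP => i k; rewrite mul_mx_diag !mxE.
pose chi (x : 'Z_N) : F := w ^+ (k * x).
have chiE (j : 'I_#|vertex G|) : W j k = chi (enum_val j).
  by rewrite !mxE -exprM /chi enum_val_ord.
rewrite (eq_bigr (fun j => a * (laplacian_mx G F i j * chi (enum_val j)))).
  rewrite -mulr_sumr (@laplacian_mxE G F chi) laplacian_circulant.
  have := chiE i; rewrite !mxE => ->; rewrite mulrCA; congr (_ * _).
  rewrite mulr_sumr; apply: eq_bigr => m _.
  have := addE (enum_val i) (nth 0%N c m) k.
  have := addE (enum_val i - (nth 0%N c m)%:R) (nth 0%N c m) k.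
  rewrite subrK -/(chi _) -/(chi _) -/(chi _) => chi1 ->.
  set u := w ^+ (k * _) in chi1 *.
  have u0 : u != 0 by rewrite expf_neq0.
  have -> : chi (enum_val i - (nth 0 c m)%:R) = chi (enum_val i) * u^-1.
    by rewrite chi1 mulfK.
  ring.
by move=> j _; rewrite chiE mxE mulrA.
Qed.

End Circulant.

(** * Complex exponentials e^(it) and roots of unity *)

Section Cis.
Variable R : realType.
Implicit Types s t : R.

Definition cis t : R[i] := (cos t +i* sin t)%C.

Lemma cisD s t : cis (s + t) = cis s * cis t.
Proof.
by rewrite /cis cosD sinD [sin s * _ + _]addrC.
Qed.

Lemma cis0 : cis 0 = 1.
Proof. by rewrite /cis cos0 sin0. Qed.

Lemma cisMn n t : cis (n%:R * t) = cis t ^+ n.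
Proof.
elim: n => [|n IHn]; first by rewrite mul0r cis0.
by rewrite exprSr -IHn -cisD -natr1 mulrDl mul1r.
Qed.

Lemma cisN t : cis t * cis (- t) = 1.
Proof. by rewrite -cisD subrr cis0. Qed.

Lemma cis_neq0 t : cis t != 0.
Proof.
by apply: contraTneq (oner_neq0 R[i]) => c0; rewrite -(cisN t) c0 mul0r eqxx.
Qed.

Lemma cisV t : (cis t)^-1 = cis (- t).
Proof. by apply: (mulfI (cis_neq0 t)); rewrite cisN mulfV ?cis_neq0. Qed.

Lemma cisDV t : cis t + (cis t)^-1 = (2 * cos t)%:C%C.
Proof.
rewrite cisV /cis cosN sinN; apply/eqP; rewrite eq_complex /= subrr eqxx andbT.
by rewrite mulr2n mulrDl mul1r.
Qed.

Lemma cis2pi : cis (2 * pi) = 1.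
Proof. by rewrite mulr_natl /cis cos2pi sin2pi. Qed.

Lemma cis_primitive n : (0 < n)%N -> n.-primitive_root (cis (2 * pi / n%:R)).
Proof.
move=> n_gt0; have n0 : n%:R != 0 :> R by rewrite pnatr_eq0 -lt0n.
apply/andP; split=> //; apply/forallP => -[i /= lt_in].
rewrite unity_rootE -cisMn.
apply/eqP; have [i_n|ni] := eqVneq i.+1 n.
  have -> : i.+1%:R * (2 * pi / n%:R) = 2 * pi :> R by rewrite i_n; field.
  by rewrite cis2pi eqxx.
have i_lt : (i.+1 < n)%N by rewrite ltn_neqAle ni lt_in.
(* The half angle lies strictly between 0 and pi, so cos (2 x) = 1 - 2 sin^2 x < 1. *)
pose x : R := pi * (i.+1%:R / n%:R).
have -> : i.+1%:R * (2 * pi / n%:R) = x *+ 2 by rewrite /x -mulr_natl; field.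
have x_gt0 : 0 < sin x.
  apply: sin_gt0_pi; rewrite /x mulr_gt0 ?pi_gt0 ?divr_gt0 ?ltr0n //=.
  by rewrite gtr_pMr ?pi_gt0 // ltr_pdivrMr ?ltr0n // mul1r ltr_nat.
apply/negbTE/eqP => /(congr1 (@complex.Re R)) /=; rewrite cos_mulr2n.
have := cos2Dsin2 x => c2s2 c2.
have : 0 < sin x ^+ 2 by rewrite exprn_gt0.
move: c2s2 c2; rewrite !mulr2n; lra.
Qed.

End Cis.

Definition circulant_eigenvalue (R : realType) N (c : seq nat) k : R :=
  \sum_(i < size c) (2 - 2 * cos (2 * pi * k%:R * (nth 0%N c i)%:R / N%:R)).

(** Computed over [R[i]], where a primitive root exists, then pulled back by injectivity. The scalar
    a serves both L (a = 1) and -L (a = -1). *)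
Lemma char_poly_circulant (R : realType) N c (a : R) : (1 < N)%N ->
  char_poly (a *: laplacian_mx (circulant N c) R)
    = \prod_(0 <= k < N) ('X - (a * circulant_eigenvalue R N c k)%:P).
Proof.
move=> N_gt1; have N0 : N%:R != 0 :> R by rewrite pnatr_eq0 -lt0n ltnW.
apply: (map_poly_inj (real_complex R)); rewrite map_char_poly map_mxZ.
have -> : map_mx (real_complex R) (laplacian_mx (circulant N c) R)
    = laplacian_mx (circulant N c) R[i].
  apply/matrixP => i j; rewrite !mxE rmorph_sum; apply: eq_bigr => y _.
  by rewrite rmorphMn rmorphB !rmorph_nat.
rewrite (char_poly_circulant_root _ _ _ (cis_primitive R (ltnW N_gt1))) //.
rewrite rmorph_prod; apply: eq_bigr => k _.
rewrite rmorphB /= map_polyX map_polyC /=; congr (_ - _%:P).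
rewrite [RHS]rmorphM [X in _ = _ * X]rmorph_sum; congr (_ * _).
apply: eq_bigr => i _; rewrite -cisMn cisDV.
rewrite rmorphB rmorph_nat; congr (_ - (2 * cos _)%:C%C).
by rewrite natrM; field.
Qed.

Lemma circulant_eigenvalue0 (R : realType) N c :
  circulant_eigenvalue R N c 0 = 0.
Proof.
rewrite /circulant_eigenvalue big1 // => i _.
by rewrite mulr0 !mul0r cos0 mulr1 subrr.
Qed.

Lemma num_spanning_trees_circulant (R : realType) N c : (1 < N)%N ->
  (num_spanning_trees (circulant N c) * N)%:R
    = \prod_(1 <= k < N) circulant_eigenvalue R N c k.
Proof.
move=> N_gt1.
have -> : (num_spanning_trees (circulant N c) * N)%:R
    = (char_poly (- laplacian_mx (circulant N c) R))`_1.
  by rewrite matrix_tree card_Z.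
rewrite -scaleN1r char_poly_circulant // big_ltn; last exact: ltnW.
rewrite circulant_eigenvalue0 mulr0 subr0 coefXM /= -horner_coef0 horner_prod.
by apply: eq_bigr => k _; rewrite !hornerE mulN1r opprK.
Qed.

(** * Trigonometric products *)

(** Homogenizes X^n - 1 = prod (X - w^j): evaluate at x / y and multiply by y^n. *)
Lemma prod_sub_prim_root (F : fieldType) n (w x y : F) :
  n.-primitive_root w -> y != 0 ->
  \prod_(0 <= j < n) (x - y * w ^+ j) = x ^+ n - y ^+ n.
Proof.
move=> prim_w y0.
have := congr1 (fun p => y ^+ n * p.[x / y]) (factor_Xn_sub_1 prim_w).
rewrite horner_prod !hornerE mulrBr mulr1 exprMn exprVn mulrCA.
rewrite mulfV ?expf_neq0 // mulr1 => <-.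
rewrite -[X in y ^+ X]subn0 -prodr_const_nat -big_split /=.
by apply: eq_bigr => j _; rewrite !hornerE mulrBr mulrCA mulfV // mulr1.
Qed.

Lemma primitive_rootV (F : fieldType) n (w : F) :
  n.-primitive_root w -> n.-primitive_root w^-1.
Proof.
move=> prim_w; have n_gt0 := prim_order_gt0 prim_w.
have -> : w^-1 = w ^+ n.-1.
  have w0 : w != 0 by rewrite (prim_root_eq0 prim_w) -lt0n.
  apply: (mulfI w0); rewrite mulfV // -exprS prednK //.
  by rewrite (prim_expr_order prim_w).
by rewrite prim_root_exp_coprime // coprimePn.
Qed.

(** For ab = 1, a + b - (u + 1/u) = (a - u)(1 - b/u). With u = e^(it) w^j the two products are a^n -
    e^(int) and 1 - b^n e^(-int), and the same identity read backwards recombines them. *)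
Lemma prod_sub_cos (R : realType) n (a b t : R) : (0 < n)%N -> a * b = 1 ->
  \prod_(0 <= j < n) (a + b - 2 * cos (t + j%:R * (2 * pi / n%:R)))
    = a ^+ n + b ^+ n - 2 * cos (n%:R * t).
Proof.
move=> n_gt0 ab; have prim_w := cis_primitive R n_gt0.
set th := 2 * pi / n%:R in prim_w *.
have splitE (x y u : R[i]) : u != 0 -> x * y = 1 ->
    x + y - (u + u^-1) = (x - u) * (1 - y * u^-1).
  move=> u0 xy; transitivity (x + y * (u * u^-1) - (u + x * y * u^-1)).
    by rewrite mulfV // mulr1 xy mul1r.
  by ring.
have abC : a%:C%C * b%:C%C = 1 by rewrite -rmorphM ab.
have z0 := cis_neq0 t; set z := cis t in z0.
apply: (fmorph_inj (real_complex R)); rewrite rmorph_prod.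
rewrite (eq_bigr (fun j => (a%:C%C - z * cis th ^+ j)
    * (1 - (b%:C%C * z^-1) * (cis th)^-1 ^+ j))); last first.
  move=> j _; rewrite rmorphB rmorphD /= -cisDV cisD cisMn.
  by rewrite splitE ?mulf_neq0 ?expf_neq0 ?cis_neq0 // invfM exprVn mulrA.
rewrite big_split /= (prod_sub_prim_root _ prim_w) //.
have b0 : b%:C%C != 0.
  by apply: contra_eq_neq abC => ->; rewrite mulr0 eq_sym oner_neq0.
rewrite (prod_sub_prim_root _ (primitive_rootV prim_w)); last first.
  by rewrite mulf_neq0 ?invr_eq0.
rewrite rmorphB rmorphD /= -cisDV cisMn !rmorphXn splitE ?expf_neq0 //.
  by rewrite expr1n exprMn exprVn.
by rewrite -exprMn abC expr1n.
Qed.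

(** Here 2 - (u + 1/u) = (1 - u)(1 - 1/u), and each of the two products is 1 + X + ... + X^(n-1) at
    X = 1, namely n. *)
Lemma prod_2_sub_cos (R : realType) n : (0 < n)%N ->
  \prod_(1 <= j < n) (2 - 2 * cos (j%:R * (2 * pi / n%:R))) = n%:R ^+ 2 :> R.
Proof.
move=> n_gt0; have prim_w := cis_primitive R n_gt0.
set th := 2 * pi / n%:R in prim_w *.
have prod1 (w : R[i]) : n.-primitive_root w ->
    \prod_(1 <= j < n) (1 - w ^+ j) = n%:R.
  move=> prim_v; have := factor_Xn_sub_1 prim_v.
  rewrite big_ltn // expr0 subrX1.
  have X1 : ('X - 1%:P : {poly R[i]}) != 0 by rewrite polyXsubC_eq0.
  move=> /(mulfI X1)/(congr1 (fun p => p.[1])).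
  rewrite horner_prod.
  rewrite (eq_bigr (fun j => 1 - w ^+ j)) => [->|j _]; last by rewrite !hornerE.
  rewrite horner_sum (eq_bigr (fun=> 1)) => [|j _]; last first.
    by rewrite !hornerE expr1n.
  by rewrite sumr_const card_ord.
apply: (fmorph_inj (real_complex R)); rewrite rmorph_prod.
rewrite (eq_bigr (fun j => (1 - cis th ^+ j) * (1 - (cis th)^-1 ^+ j))).
  rewrite big_split /= !prod1 ?primitive_rootV // rmorphXn rmorph_nat.
  by rewrite expr2.
move=> j _; rewrite rmorphB /= -cisDV cisMn rmorph_nat exprVn.
have := cis_neq0 th => /(expf_neq0 j) u0.
set u := cis th ^+ j in u0 *.
transitivity (1 + u * u^-1 - (u + u^-1)); last by ring.
by rewrite mulfV.
Qed.

(** * Eigenvalues of the small and the large circulant graph *)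

Lemma muE (R : realType) d beta (gamma : (d - 1).-tuple nat) k :
  mu R beta gamma k = circulant_eigenvalue R beta gamma k.
Proof.
rewrite /mu /circulant_eigenvalue sumrB sumr_const card_ord size_tuple.
rewrite mulr_natr -mulr_sumr; congr (_ - 2 * _).
by apply: eq_bigr => m _; rewrite (tnth_nth 0%N).
Qed.

Lemma circulant_eigenvalue_ge0 (R : realType) N c k :
  0 <= circulant_eigenvalue R N c k.
Proof.
apply: sumr_ge0 => i _; rewrite subr_ge0 -[leRHS]mulr1.
by rewrite ler_pM2l ?cos_le1.
Qed.

Lemma cosDn2pi (R : realType) (x : R) n : cos (x + n%:R * (2 * pi)) = cos x.
Proof.
apply: (fmorph_inj (real_complex R)).
have two0 : (2%:R : R[i]) != 0 by rewrite pnatr_eq0.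
have := cisDV (x + n%:R * (2 * pi)).
rewrite cisD cisMn cis2pi expr1n mulr1 cisDV !rmorphM /=.
by move/mulfI => ->; rewrite // rmorph_nat.
Qed.

Lemma circulant_eigenvalueD (R : realType) N c k j : (0 < N)%N ->
  circulant_eigenvalue R N c (k + j * N) = circulant_eigenvalue R N c k.
Proof.
move=> N_gt0; have N0 : N%:R != 0 :> R by rewrite pnatr_eq0 -lt0n.
apply: eq_bigr => i _; set ci := nth _ _ _; congr (_ - 2 * _).
rewrite -[RHS](cosDn2pi _ (j * ci)); congr cos.
by rewrite natrD !natrM; field.
Qed.

(** A jump g n modulo N n turns by the same angle as g modulo N; only the jump 1 adds a new term. *)
Lemma circulant_eigenvalue_blowup (R : realType) N n c k :
  (0 < N)%N -> (0 < n)%N ->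
  circulant_eigenvalue R (N * n) (1%N :: [seq (g * n)%N | g <- c]) k
    = 2 - 2 * cos (2 * pi * k%:R / (N * n)%:R) + circulant_eigenvalue R N c k.
Proof.
move=> N_gt0 n_gt0; have N0 : N%:R != 0 :> R by rewrite pnatr_eq0 -lt0n.
have n0 : n%:R != 0 :> R by rewrite pnatr_eq0 -lt0n.
rewrite /circulant_eigenvalue /= big_ord_recl /= mulr1 size_map; congr (_ + _).
apply: eq_bigr => i _; rewrite /bump /= add0n (nth_map 0%N) //.
congr (_ - 2 * cos _).
by rewrite !natrM; field; rewrite N0.
Qed.

Lemma prod_nat_blocks (R : comNzRingType) N n (F : nat -> R) :
  (0 < N)%N -> (0 < n)%N ->
  \prod_(1 <= k < N * n) F k
    = (\prod_(1 <= j < n) F (j * N)%N)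
      * \prod_(1 <= l < N) \prod_(0 <= j < n) F (l + j * N)%N.
Proof.
(* The missing index 0 is filled with a factor 1, so that the range splits into n full blocks of
   length N. *)
move=> N_gt0 n_gt0; pose h k := if k == 0%N then 1 else F k.
have -> : \prod_(1 <= k < N * n) F k = \prod_(0 <= k < n * N) h k.
  rewrite mulnC [RHS]big_ltn ?muln_gt0 ?n_gt0 // mul1r.
  by apply: eq_big_nat => -[].
rewrite big_nat_mul.
rewrite (eq_bigr (fun j => \prod_(0 <= l < N) h (l + j * N)%N)); last first.
  move=> j _; rewrite -{1}[(j * N)%N]add0n big_addn; congr bigop.
  by rewrite mulSn addnK.
rewrite exchange_big_nat big_ltn //=; congr (_ * _).
  rewrite big_ltn // mul1r; apply: eq_big_nat => j /andP[j_gt0 _].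
  by rewrite /h add0n muln_eq0 !gtn_eqF.
apply: eq_big_nat => l /andP[l_gt0 _]; apply: eq_bigr => j _.
by rewrite /h addn_eq0 gtn_eqF.
Qed.

Theorem theorem1 (R : realType) (d beta : nat) (gamma : (d - 1).-tuple nat)
    (d_ge1 : (1 <= d)%N) (beta_ge2 : (2 <= beta)%N)
    (gamma_sorted : sorted leq gamma)
    (gamma_bounds : forall m : 'I_(d - 1),
       (1 <= tnth gamma m <= beta %/ 2)%N) :
  char_poly (laplacian_mx (circulant beta gamma) R)
    = \prod_(0 <= k < beta) ('X - (mu R beta gamma k)%:P)
  /\
  forall n : nat, (1 <= n)%N ->
    (num_spanning_trees
       (circulant (beta * n) (1%N :: [seq (g * n)%N | g <- gamma])))%:R
    = n%:R / beta%:R *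
      \prod_(1 <= k < beta)
        ((mu R beta gamma k / 2 + 1
            + Num.sqrt (mu R beta gamma k ^+ 2 / 4 + mu R beta gamma k)) ^+ n
         + (mu R beta gamma k / 2 + 1
            - Num.sqrt (mu R beta gamma k ^+ 2 / 4 + mu R beta gamma k)) ^+ n
         - 2 * cos (2 * pi * k%:R / beta%:R)).
Proof.
have beta_gt0 := ltnW beta_ge2.
split.
  rewrite -[laplacian_mx _ _]scale1r char_poly_circulant //.
  by apply: eq_bigr => k _; rewrite mul1r muE.
move=> n n_gt0; set c := _ :: _; set tau := num_spanning_trees _.
have N_gt1 : (1 < beta * n)%N by apply: leq_trans (leq_pmulr _ _).
have b0 : beta%:R != 0 :> R by rewrite pnatr_eq0 -lt0n.
have n0 : n%:R != 0 :> R by rewrite pnatr_eq0 -lt0n.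
have := num_spanning_trees_circulant R c N_gt1; rewrite -/tau.
rewrite prod_nat_blocks //.
(* In residue class 0 the small-graph part of the eigenvalue vanishes. *)
have -> : \prod_(1 <= j < n) circulant_eigenvalue R (beta * n) c (j * beta)
    = n%:R ^+ 2.
  rewrite -prod_2_sub_cos //; apply: eq_bigr => j _.
  rewrite circulant_eigenvalue_blowup //.
  rewrite -[X in circulant_eigenvalue _ _ _ X]add0n.
  rewrite circulant_eigenvalueD // circulant_eigenvalue0 addr0.
  congr (_ - 2 * cos _); by rewrite !natrM; field; rewrite n0.
have -> : \prod_(1 <= l < beta) \prod_(0 <= j < n)
      circulant_eigenvalue R (beta * n) c (l + j * beta)
    = \prod_(1 <= l < beta)
        ((mu R beta gamma l / 2 + 1
            + Num.sqrt (mu R beta gamma l ^+ 2 / 4 + mu R beta gamma l)) ^+ n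
         + (mu R beta gamma l / 2 + 1
            - Num.sqrt (mu R beta gamma l ^+ 2 / 4 + mu R beta gamma l)) ^+ n
         - 2 * cos (2 * pi * l%:R / beta%:R)).
  apply: eq_bigr => l _; set m := mu _ _ _ _; set q := m ^+ 2 / 4 + m.
  have m_ge0 : 0 <= m by rewrite /m muE circulant_eigenvalue_ge0.
  have q_ge0 : 0 <= q by rewrite addr_ge0 // divr_ge0 // exprn_ge0.
  (* The two bases have sum m + 2 and product 1, so [prod_sub_cos] applies to the factors m + 2 - 2
     cos. *)
  have ab : (m / 2 + 1 + Num.sqrt q) * (m / 2 + 1 - Num.sqrt q) = 1.
    by rewrite mulrC -subr_sqr sqr_sqrtr // /q; field.
  have -> : 2 * pi * l%:R / beta%:R
      = n%:R * (2 * pi * l%:R / (beta * n)%:R) :> R.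
    by rewrite natrM; field; rewrite n0.
  rewrite -prod_sub_cos //; apply: eq_bigr => j _.
  rewrite circulant_eigenvalue_blowup // circulant_eigenvalueD // -muE -/m.
  have -> : 2 * pi * (l + j * beta)%:R / (beta * n)%:R
      = 2 * pi * l%:R / (beta * n)%:R + j%:R * (2 * pi / n%:R) :> R.
    by rewrite natrD !natrM; field; rewrite n0.
  by field.
(* It remains to divide tau * (beta n) = n^2 P by beta n. *)
set P := \prod_(_ <= _ < _) _; rewrite !natrM => tauE.
by apply: (mulIf (mulf_neq0 b0 n0)); rewrite tauE; field.
Qed.
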